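(* Let $M$ and $N$ be $n$-manifolds with bounded geometry. Every $L$-BLD-mapping $f\colon M\to N$ is a discrete $L$-LQ-mapping. Conversely, every discrete $L$-LQ-mapping $f\colon M\to N$ is an $L'$-BLD-mapping, where $L'\ge 1$ depends only on $L$ and the bounded geometry constants of $M$ and $N$ (if both $M,N$ have $C$-bounded geometry one may take $L'=C^4L$). Furthermore, if $M$ and $N$ have strongly bounded geometry, one may take $L'=L$.
   Context: A metric manifold $M$ is said to have ($C$-)bounded geometry if it is a complete length space and there exist constants $C\ge 1$ and $R>0$ such that for every $x\in M$ there is a $C$-bilipschitz map $B_M(x,R)\to B_{\mathbb{R}^n}(0,R)$; here $B_X(x,r)$ denotes the open ball of radius $r$ about $x$ in a metric space $X$. $M$ has strongly bounded geometry if for every $C\ge1$ such a radius $R>0$ can be found. A map $f\colon M\to N$ between metric spaces is an $L$-BLD-mapping ($L\ge1$) if it is continuous, open and discrete and for every path $\beta\colon[0,1]\to M$ one has $L^{-1}\ell(\beta)\le \ell(f\circ\beta)\le L\,\ell(\beta)$, where $\ell$ denotes length. A map $f\colon M\to N$ is an $L$-Lipschitz quotient ($L$-LQ) mapping if $B_N(f(x),L^{-1}r)\subset f(B_M(x,r))\subset B_N(f(x),Lr)$ for all $x\in M$ and $r>0$. *)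

(* Defs.v *)
From Stdlib Require Import Reals List Sorting.Sorted.
Import ListNotations.
Open Scope R_scope.

Section Metric.
Context {X : Type} (d : X -> X -> R).

Definition is_metric : Prop :=
  (forall x y, 0 <= d x y) /\ (forall x, d x x = 0) /\
  (forall x y, d x y = 0 -> x = y) /\ (forall x y, d x y = d y x) /\
  (forall x y z, d x z <= d x y + d y z).

Definition ball (x : X) (r : R) (y : X) : Prop := d x y < r.

Definition is_open (U : X -> Prop) : Prop :=
  forall x, U x -> exists r, 0 < r /\ forall y, ball x r y -> U y.

Definition complete : Prop :=
  forall u : nat -> X,
    (forall eps, 0 < eps -> exists N, forall p q, (N <= p)%nat -> (N <= q)%nat -> d (u p) (u q) < eps) ->
    exists l, forall eps, 0 < eps -> exists N, forall p, (N <= p)%nat -> d (u p) l < eps.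

(* a path: a map [0,1] -> X (given on R, only its values on [0,1] matter),
   continuous on [0,1] *)
Definition is_path (b : R -> X) : Prop :=
  forall t, 0 <= t <= 1 -> forall eps, 0 < eps -> exists delta, 0 < delta /\
    forall s, 0 <= s <= 1 -> Rabs (s - t) < delta -> d (b s) (b t) < eps.

Fixpoint chain_sum (b : R -> X) (t0 : R) (ts : list R) : R :=
  match ts with
  | [] => 0
  | t :: ts' => d (b t0) (b t) + chain_sum b t ts'
  end.

(* length_le b c  <->  l(b) <= c, where l(b) in [0, +oo] is the length
   (supremum of inscribed polygonal sums over partitions of [0,1]). *)
Definition length_le (b : R -> X) (c : R) : Prop :=
  forall ts : list R, Sorted Rle (0 :: ts) -> Forall (fun t => t <= 1) ts ->
    chain_sum b 0 ts <= c.

Definition complete_length_space : Prop :=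
  complete /\
  forall x y eps, 0 < eps -> exists b, is_path b /\ b 0 = x /\ b 1 = y /\
     length_le b (d x y + eps).
End Metric.

(* R^n realised as sequences vanishing from index n on, with the Euclidean metric *)
Definition in_Rn (n : nat) (v : nat -> R) : Prop := forall i, (n <= i)%nat -> v i = 0.
Definition eucl (n : nat) (u v : nat -> R) : R :=
  sqrt (sum_f_R0 (fun i => (u i - v i) ^ 2) n).
Definition origin : nat -> R := fun _ => 0.

Definition bilip_charts (n : nat) {X : Type} (d : X -> X -> R) (C Rad : R) : Prop :=
  forall x, exists phi : X -> (nat -> R),
    (forall y, ball d x Rad y -> in_Rn n (phi y) /\ eucl n origin (phi y) < Rad) /\
    (forall v, in_Rn n v -> eucl n origin v < Rad -> exists y, ball d x Rad y /\ phi y = v) /\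
    (forall y z, ball d x Rad y -> ball d x Rad z ->
        / C * d y z <= eucl n (phi y) (phi z) /\ eucl n (phi y) (phi z) <= C * d y z).

Definition bounded_geometry (n : nat) {X : Type} (d : X -> X -> R) (C Rad : R) : Prop :=
  complete_length_space d /\ 1 <= C /\ 0 < Rad /\ bilip_charts n d C Rad.

Definition strongly_bounded_geometry (n : nat) {X : Type} (d : X -> X -> R) : Prop :=
  complete_length_space d /\
  forall C, 1 <= C -> exists Rad, 0 < Rad /\ bilip_charts n d C Rad.

Section Maps.
Context {X Y : Type} (dX : X -> X -> R) (dY : Y -> Y -> R) (f : X -> Y).

Definition continuous_map : Prop :=
  forall x eps, 0 < eps -> exists delta, 0 < delta /\
    forall y, dX x y < delta -> dY (f x) (f y) < eps.

Definition open_map : Prop :=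
  forall U, is_open dX U -> is_open dY (fun z => exists x, U x /\ f x = z).

Definition discrete_map : Prop :=
  forall x, exists r, 0 < r /\ forall x', dX x x' < r -> f x' = f x -> x' = x.

(* L-BLD: continuous, open, discrete, and L^{-1} l(b) <= l(f o b) <= L l(b)
   for every path b (lengths in [0,+oo]) *)
Definition BLD (L : R) : Prop :=
  continuous_map /\ open_map /\ discrete_map /\
  forall b : R -> X, is_path dX b ->
    (forall c, length_le dX b c -> length_le dY (fun t => f (b t)) (L * c)) /\
    (forall c, length_le dY (fun t => f (b t)) c -> length_le dX b (L * c)).

Definition LQ (L : R) : Prop :=
  forall x r, 0 < r ->
    (forall z, ball dY (f x) (r / L) z -> exists x', ball dX x r x' /\ f x' = z) /\
    (forall x', ball dX x r x' -> ball dY (f x) (L * r) (f x')).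
End Maps.

(* Main.v *)
(* Discrete LQ implies BLD with the same constant, whatever the geometry: if u is close to x,
   the co-Lipschitz bound at f u gives a preimage of f x within L d(f u, f x) of u, and by
   discreteness this preimage is x itself. Thus d(u, x) <= L d(f u, f x) for all u near x, and
   subdividing [0,1] finely around well-chosen times turns this into l(b) <= L l(f o b).

   BLD implies LQ: a short path starting at f x lifts to a path starting at x. As in Floyd's
   theorem on light open maps, one picks points of the fibres over finer and finer grids of
   times, consecutive points being close since f is uniformly open near x; fine chains with
   small image have small diameter since f is discrete, so a limit exists by Arzela-Ascoli. The
   charts are used only for the total boundedness of small balls. Lifting almost shortest
   paths, one can decrease d(f u, z) at a cost of at most K > L times the decrease, and
   Ekeland's principle then leads from x to a preimage of z within K d(f x, z). *)
Require Import Defs.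
From Stdlib Require Import Reals Lra Lia List Sorting.Sorted ClassicalEpsilon.
Import ListNotations.
Open Scope R_scope.

(** * Metrics, continuous paths and induction on intervals *)

Lemma dist_ge0 {X} {d : X -> X -> R} (Hd : is_metric d) x y : 0 <= d x y.
Proof. apply Hd. Qed.

Lemma dist_refl {X} {d : X -> X -> R} (Hd : is_metric d) x : d x x = 0.
Proof. apply Hd. Qed.

Lemma dist_eq0 {X} {d : X -> X -> R} (Hd : is_metric d) x y : d x y = 0 -> x = y.
Proof. apply Hd. Qed.

Lemma dist_sym {X} {d : X -> X -> R} (Hd : is_metric d) x y : d x y = d y x.
Proof. apply Hd. Qed.

Lemma dist_tri {X} {d : X -> X -> R} (Hd : is_metric d) x y z :
  d x z <= d x y + d y z.
Proof. apply Hd. Qed.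

Lemma inv_INR_S_pos k : 0 < / INR (S k).
Proof. apply Rinv_0_lt_compat, lt_0_INR; lia. Qed.

Lemma inv_INR_S_small eps :
  0 < eps -> exists N, forall k, (N <= k)%nat -> / INR (S k) < eps.
Proof.
  intros He. destruct (archimed_cor1 eps He) as [N [HN HN0]].
  exists N. intros k Hk. apply Rle_lt_trans with (/ INR N); [|exact HN].
  apply Rinv_le_contravar; [apply lt_0_INR; lia|apply le_INR; lia].
Qed.

(** Compactness of [0,1] in inductive form. The supremum of the end points reached from the start is
    itself reached, by the local hypothesis there, which also leads past it unless the interval is
    exhausted. *)
Lemma interval_induction (P : R -> R -> Prop) :
  (forall u v w, 0 <= u <= v -> v <= w <= 1 -> P u v -> P v w -> P u w) ->
  (forall t, 0 <= t <= 1 -> exists delta, 0 < delta /\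
     forall u v, 0 <= u <= t -> t <= v <= 1 -> t - delta < u -> v < t + delta -> P u v) ->
  forall u v, 0 <= u <= v -> v <= 1 -> P u v.
Proof.
  intros Htr Hloc u w Huw Hw1.
  assert (Hrefl : forall t, 0 <= t <= 1 -> P t t).
  { intros t Ht. destruct (Hloc t Ht) as [dl [Hdl H]]. apply H; lra. }
  set (E := fun v => u <= v <= w /\ P u v).
  assert (HEu : E u) by (split; [lra|apply Hrefl; lra]).
  destruct (completeness E) as [s [Hub Hlub]].
  { exists w. intros v [Hv _]. lra. }
  { exists u; exact HEu. }
  assert (Hus : u <= s) by (apply Hub, HEu).
  assert (Hsw : s <= w) by (apply Hlub; intros v [Hv _]; lra).
  destruct (Hloc s ltac:(lra)) as [dl [Hdl H]].
  assert (Hv : exists v, E v /\ s - dl < v).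
  { apply NNPP. intros Hn. assert (s <= s - dl); [|lra].
    apply Hlub. intros v Hv. apply Rnot_lt_le. intros Hlt. apply Hn; eauto. }
  destruct Hv as [v [[Hv HPv] Hlt]].
  assert (Hvs : v <= s) by (apply Hub; split; assumption).
  assert (HPs : P u s) by (apply Htr with v; try lra; auto; apply H; lra).
  destruct (Rle_lt_dec w s) as [Hle|Hlt'].
  { replace w with s by lra. exact HPs. }
  set (v' := Rmin w (s + dl / 2)).
  assert (Hv' : s < v' <= w /\ v' <= s + dl / 2).
  { unfold v', Rmin. destruct (Rle_dec w (s + dl / 2)); lra. }
  assert (v' <= s); [|lra].
  apply Hub. split; [lra|]. apply Htr with s; try lra; auto. apply H; lra.
Qed.

Lemma path_uniform {X} {d : X -> X -> R} (Hd : is_metric d) b :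
  is_path d b -> forall eps, 0 < eps -> exists delta, 0 < delta /\
    forall s t, 0 <= s <= 1 -> 0 <= t <= 1 -> Rabs (t - s) < delta -> d (b s) (b t) < eps.
Proof.
  intros Hb eps He.
  (* Only [s] is confined to [[u, v]], while [t] ranges over [0,1]: pairs on both sides of a cut
     then need no separate estimate. *)
  destruct (interval_induction (fun u v => exists delta, 0 < delta /\
    forall s t, u <= s <= v -> 0 <= t <= 1 -> Rabs (t - s) < delta -> d (b s) (b t) < eps))
    with (u := 0) (v := 1) as [dl [Hdl H]]; try lra.
  - intros u v w Huv Hvw [d1 [Hd1 H1]] [d2 [Hd2 H2]].
    exists (Rmin d1 d2). split; [apply Rmin_pos; assumption|].
    intros s t Hs Ht Hst.
    pose proof (Rmin_l d1 d2). pose proof (Rmin_r d1 d2).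
    destruct (Rle_lt_dec s v); [apply H1|apply H2]; lra.
  - intros t Ht. destruct (Hb t Ht (eps / 2) ltac:(lra)) as [dl [Hdl H]].
    exists (dl / 2). split; [lra|]. intros u v Hu Hv Hu' Hv'.
    exists (dl / 2). split; [lra|]. intros s s' Hs Hs' Hss.
    assert (d (b s) (b t) < eps / 2).
    { apply H; [lra|]. apply Rabs_def1; lra. }
    assert (d (b s') (b t) < eps / 2).
    { apply H; [lra|]. apply Rabs_def2 in Hss. apply Rabs_def1; lra. }
    rewrite (dist_sym Hd (b s') (b t)) in *.
    pose proof (dist_tri Hd (b s) (b t) (b s')). lra.
  - exists dl. split; auto.
Qed.

Lemma path_dist_surj {X} {d : X -> X -> R} (Hd : is_metric d) b r :
  is_path d b -> 0 <= r <= d (b 0) (b 1) ->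
  exists t, 0 <= t <= 1 /\ d (b 0) (b t) = r.
Proof.
  intros Hb Hr. apply NNPP. intros Hn.
  assert (Hne : forall t, 0 <= t <= 1 -> d (b 0) (b t) <> r) by (intros t Ht E; apply Hn; eauto).
  pose proof (dist_refl Hd (b 0)).
  (* A distance that never equals [r] stays below [r] along the whole path, against its value at
     1. *)
  assert (H01 : d (b 0) (b 0) < r -> d (b 0) (b 1) < r).
  2:{ pose proof (Hne 0 ltac:(lra)). pose proof (Hne 1 ltac:(lra)). lra. }
  apply (interval_induction (fun u v => d (b 0) (b u) < r -> d (b 0) (b v) < r)); try lra.
  - auto.
  - intros t Ht. set (g := Rabs (d (b 0) (b t) - r)).
    assert (Hg : 0 < g) by (apply Rabs_pos_lt; specialize (Hne t Ht); lra).
    destruct (Hb t Ht g Hg) as [dl [Hdl Hc]].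
    exists dl. split; [assumption|]. intros u v Hu Hv Hu' Hv' Hlt.
    assert (Hcu : d (b u) (b t) < g) by (apply Hc; [lra|apply Rabs_def1; lra]).
    assert (Hcv : d (b v) (b t) < g) by (apply Hc; [lra|apply Rabs_def1; lra]).
    pose proof (dist_tri Hd (b 0) (b u) (b t)).
    pose proof (dist_tri Hd (b 0) (b t) (b v)).
    rewrite (dist_sym Hd (b t) (b v)) in *.
    unfold g, Rabs in *. destruct (Rcase_abs (d (b 0) (b t) - r)); lra.
Qed.

(** * Lengths and subdivisions *)

Lemma length_le_ge0 {X} (d : X -> X -> R) b c : length_le d b c -> 0 <= c.
Proof.
  intros H. apply (H []); [|constructor]. constructor; constructor.
Qed.

Lemma length_le_chain {X} (d : X -> X -> R) b c s t :
  length_le d b c -> 0 <= s <= t -> t <= 1 -> d (b 0) (b s) + d (b s) (b t) <= c.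
Proof.
  intros H Hs Ht. specialize (H [s; t]). simpl in H. rewrite Rplus_0_r in H.
  apply H; repeat first [lra | constructor].
Qed.

Lemma length_le_endpoints {X} {d : X -> X -> R} (Hd : is_metric d) b c t :
  length_le d b c -> 0 <= t <= 1 -> d (b 0) (b t) <= c.
Proof.
  intros H Ht. pose proof (length_le_chain d b c t t H ltac:(lra) ltac:(lra)).
  rewrite (dist_refl Hd) in *. lra.
Qed.

(** Needed because a lift projects to the given path on [0,1] only, whereas paths are functions on
    [R]. *)
Lemma length_le_ext {X} (d : X -> X -> R) b b' c :
  (forall t, 0 <= t <= 1 -> b t = b' t) -> length_le d b c -> length_le d b' c.
Proof.
  intros Hbb H ts Hs Hf.
  assert (E : forall l t0, 0 <= t0 <= 1 -> Sorted Rle (t0 :: l) -> Forall (fun t => t <= 1) l ->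
     chain_sum d b' t0 l = chain_sum d b t0 l).
  { induction l as [|t l IH]; intros t0 H0 Hs' Hf'; [reflexivity|]. simpl.
    apply Sorted_inv in Hs' as [Hs1 Hhd]. apply HdRel_inv in Hhd.
    apply Forall_cons_iff in Hf' as [Ht1 Hf1].
    rewrite IH; try assumption; [|lra]. rewrite !Hbb by lra. reflexivity. }
  rewrite E by (assumption || lra). apply H; assumption.
Qed.

(** The list omits the start [u] and, unless empty, ends at [v]. Keeping track of the end makes
    chain sums additive under concatenation. *)
Fixpoint subdivision (u : R) (ts : list R) (v : R) : Prop :=
  match ts with
  | [] => u = v
  | t :: ts' => u <= t /\ subdivision t ts' v
  end.

Lemma subdivision_le u ts v : subdivision u ts v -> u <= v.
Proof.
  revert u. induction ts as [|t ts IH]; simpl; intros u H; [lra|].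
  destruct H as [H1 H2]. apply IH in H2. lra.
Qed.

Lemma subdivision_app ts ts' u v w :
  subdivision u ts v -> subdivision v ts' w -> subdivision u (ts ++ ts') w.
Proof.
  revert u. induction ts as [|t ts IH]; simpl; intros u H H'; [subst; assumption|].
  destruct H. split; auto.
Qed.

Lemma chain_sum_app {X} (d : X -> X -> R) b ts ts' u v :
  subdivision u ts v ->
  chain_sum d b u (ts ++ ts') = chain_sum d b u ts + chain_sum d b v ts'.
Proof.
  revert u. induction ts as [|t ts IH]; simpl; intros u H; [subst; lra|].
  destruct H as [_ H]. rewrite IH by assumption. lra.
Qed.

Lemma subdivision_sorted u ts v : subdivision u ts v ->
  Sorted Rle (u :: ts) /\ Forall (fun t => t <= v) ts.
Proof.
  revert u. induction ts as [|t ts IH]; simpl; intros u H; [repeat constructor|].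
  destruct H as [H1 H2]. pose proof (subdivision_le _ _ _ H2).
  destruct (IH _ H2) as [H3 H4].
  split; constructor; try assumption. constructor; assumption.
Qed.

(** * From discrete LQ to BLD *)

Section LipschitzQuotient.
Context {X Y : Type} {dX : X -> X -> R} {dY : Y -> Y -> R}.
Context (HdX : is_metric dX) (HdY : is_metric dY).
Context {L : R} (HL : 1 <= L) {f : X -> Y} (HLQ : LQ dX dY f L).

Lemma LQ_lipschitz x x' : dY (f x) (f x') <= L * dX x x'.
Proof.
  apply Rnot_lt_le. intros Hlt. pose proof (dist_ge0 HdX x x').
  (* The ball of this radius about [x] contains [x'], so its image bound would make
     [dY (f x) (f x')] smaller than itself. *)
  set (r := dY (f x) (f x') / L).
  assert (Hr : L * r = dY (f x) (f x')) by (unfold r; field; lra).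
  assert (Hr' : dX x x' < r) by nra.
  destruct (HLQ x r ltac:(lra)) as [_ HH]. specialize (HH x' Hr').
  unfold ball in HH. lra.
Qed.

Lemma LQ_continuous : continuous_map dX dY f.
Proof.
  intros x eps He. exists (eps / L). split; [apply Rdiv_lt_0_compat; lra|].
  intros y Hy. pose proof (LQ_lipschitz x y).
  assert (L * (eps / L) = eps) by (field; lra). nra.
Qed.

Lemma LQ_open : open_map dX dY f.
Proof.
  intros U HU z [x [Hx <-]]. destruct (HU x Hx) as [r [Hr H]].
  exists (r / L). split; [apply Rdiv_lt_0_compat; lra|]. intros z Hz.
  destruct (HLQ x r Hr) as [H1 _]. destruct (H1 z Hz) as [x' [Hx' E]]. eauto.
Qed.

(* The LQ property at [u] puts a point of the fibre of [f x] within about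
   [L * dY (f u) (f x)] of [u]; when [u] is close to [x], that point can only be [x]. *)
Lemma LQ_locally_expanding x : discrete_map dX f ->
  exists delta, 0 < delta /\
    forall u, dX x u < delta -> dX u x <= L * dY (f u) (f x).
Proof.
  intros Hdisc. destruct (Hdisc x) as [r [Hr Hx]].
  (* As [dY (f u) (f x)] is at most [L * dX x u], a point within about [L * L * dX x u] of [u] is
     within [q * dX x u < r] of [x]. *)
  set (q := 1 + L * L). assert (Hq : 0 < q) by (unfold q; nra).
  exists (r / q). split; [apply Rdiv_lt_0_compat; lra|].
  intros u Hu. assert (Hqu : q * dX x u < r).
  { apply (Rmult_lt_compat_l q) in Hu; [|assumption].
    replace (q * (r / q)) with r in Hu by (field; lra). exact Hu. }
  pose proof (LQ_lipschitz u x) as Hlip. rewrite (dist_sym HdX u x) in Hlip |- *.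
  pose proof (dist_ge0 HdY (f u) (f x)).
  apply Rnot_lt_le. intros Hlt.
  assert (HLL : L * dY (f u) (f x) <= L * (L * dX x u)) by (apply Rmult_le_compat_l; lra).
  (* Above [L * dY (f u) (f x)], so that a preimage of [f x] exists within [rho] of [u]; below
     [r - dX x u], so that this preimage is [x]; below [dX x u], which is then absurd. *)
  set (rho := (L * dY (f u) (f x) + Rmin (dX x u) (r - dX x u)) / 2).
  assert (Hrx : L * dY (f u) (f x) < Rmin (dX x u) (r - dX x u)).
  { apply Rmin_glb_lt; [assumption|]. unfold q in Hqu. nra. }
  pose proof (Rmin_l (dX x u) (r - dX x u)). pose proof (Rmin_r (dX x u) (r - dX x u)).
  assert (Hrho : L * dY (f u) (f x) < rho) by (unfold rho; lra).
  assert (Hrho' : rho < dX x u /\ rho < r - dX x u) by (unfold rho; lra).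
  destruct (HLQ u rho ltac:(nra)) as [Hpre _].
  destruct (Hpre (f x)) as [x' [Hx' E]].
  { unfold ball. apply (Rmult_lt_reg_l L); [lra|].
    replace (L * (rho / L)) with rho by (field; lra). exact Hrho. }
  unfold ball in Hx'. pose proof (dist_tri HdX x u x').
  assert (x' = x) by (apply Hx; [lra|exact E]). subst x'.
  rewrite (dist_sym HdX u x) in Hx'. lra.
Qed.

Lemma chain_sum_lipschitz b ts t0 :
  chain_sum dY (fun t => f (b t)) t0 ts <= L * chain_sum dX b t0 ts.
Proof.
  revert t0. induction ts as [|t ts IH]; intros t0; simpl; [lra|].
  pose proof (LQ_lipschitz (b t0) (b t)). specialize (IH t). lra.
Qed.

(** Local expansion at [b t] compares other points with [b t] only. So near [t] the time [t] itself
    is inserted between [u] and [v]; longer segments follow by concatenation. *)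
Lemma LQ_segment b u v : discrete_map dX f -> is_path dX b -> 0 <= u <= v -> v <= 1 ->
  exists ts, subdivision u ts v /\
    dX (b u) (b v) <= L * chain_sum dY (fun t => f (b t)) u ts.
Proof.
  intros Hdisc Hb. revert u v. apply interval_induction.
  - intros u v w Huv Hvw [ts [Hs H]] [ts' [Hs' H']].
    exists (ts ++ ts'). split; [eapply subdivision_app; eassumption|].
    rewrite (chain_sum_app _ _ _ _ _ _ Hs). pose proof (dist_tri HdX (b u) (b v) (b w)). lra.
  - intros t Ht. destruct (LQ_locally_expanding (b t) Hdisc) as [r [Hr He]].
    destruct (Hb t Ht r Hr) as [dl [Hdl Hc]]. exists dl. split; [assumption|].
    intros u v Hu Hv Hu' Hv'. exists [t; v]. simpl. split; [lra|].
    assert (Hbu : dX (b t) (b u) < r).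
    { rewrite (dist_sym HdX). apply Hc; [lra|apply Rabs_def1; lra]. }
    assert (Hbv : dX (b t) (b v) < r).
    { rewrite (dist_sym HdX). apply Hc; [lra|apply Rabs_def1; lra]. }
    apply He in Hbu. apply He in Hbv.
    rewrite (dist_sym HdX), (dist_sym HdY) in Hbv.
    pose proof (dist_tri HdX (b u) (b t) (b v)). lra.
Qed.

(** The partition is refined interval by interval; its end [v] is existential because partitions in
    [length_le] may stop before 1. *)
Lemma LQ_chain b : discrete_map dX f -> is_path dX b ->
  forall ts u, 0 <= u <= 1 -> Sorted Rle (u :: ts) -> Forall (fun t => t <= 1) ts ->
  exists ts' v, subdivision u ts' v /\ v <= 1 /\
    chain_sum dX b u ts <= L * chain_sum dY (fun t => f (b t)) u ts'.
Proof.
  intros Hdisc Hb. induction ts as [|t ts IH]; intros u Hu Hs Hf.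
  - exists [], u. simpl. repeat split; lra.
  - apply Sorted_inv in Hs as [Hs1 Hhd]. apply HdRel_inv in Hhd.
    apply Forall_cons_iff in Hf as [Ht1 Hf1].
    destruct (IH t) as [ts' [v [H5 [H6 H7]]]]; try assumption; try lra.
    destruct (LQ_segment b u t Hdisc Hb) as [ts0 [H8 H9]]; try lra.
    exists (ts0 ++ ts'), v. split; [eapply subdivision_app; eassumption|].
    split; [assumption|]. simpl. rewrite (chain_sum_app _ _ _ _ _ _ H8). lra.
Qed.

Theorem discrete_LQ_BLD : discrete_map dX f -> BLD dX dY f L.
Proof.
  intros Hdisc. split; [apply LQ_continuous|]. split; [apply LQ_open|].
  split; [assumption|]. intros b Hb. split; intros c Hc ts Hs Hf.
  - eapply Rle_trans; [apply chain_sum_lipschitz|].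
    apply Rmult_le_compat_l; [lra|]. apply Hc; assumption.
  - destruct (LQ_chain b Hdisc Hb ts 0) as [ts' [v [H1 [H2 H3]]]]; try assumption; [lra|].
    eapply Rle_trans; [exact H3|]. apply Rmult_le_compat_l; [lra|].
    destruct (subdivision_sorted _ _ _ H1) as [H4 H5].
    apply Hc; [assumption|]. eapply Forall_impl; [|exact H5]. simpl. intros; lra.
Qed.
End LipschitzQuotient.

Lemma BLD_weaken {X Y} (dX : X -> X -> R) (dY : Y -> Y -> R) (f : X -> Y) L L' :
  L <= L' -> BLD dX dY f L -> BLD dX dY f L'.
Proof.
  intros HL [Hc [Ho [Hd Hl]]]. repeat (split; [assumption|]).
  intros b Hb. destruct (Hl b Hb) as [H1 H2].
  split; intros c Hcc ts Hs Hf; apply Rle_trans with (L * c).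
  - apply H1; assumption.
  - apply Rmult_le_compat_r; [eapply length_le_ge0; eassumption|assumption].
  - apply H2; assumption.
  - apply Rmult_le_compat_r; [eapply length_le_ge0; eassumption|assumption].
Qed.

(** * Finite covers and extraction of subsequences *)

(** Total boundedness for an arbitrary closeness relation. Small pieces, unlike centres, pull back
    along any map, so that indices of sequences can be covered as well as points. *)
Definition fin_cover {T} (P : T -> Prop) (close : T -> T -> Prop) : Prop :=
  exists Qs : list (T -> Prop),
    (forall a, P a -> exists Q, In Q Qs /\ Q a) /\
    (forall Q, In Q Qs -> forall a b, Q a -> Q b -> close a b).

Lemma fin_cover_and {T} (P : T -> Prop) c c' :
  fin_cover P c -> fin_cover P c' -> fin_cover P (fun a b => c a b /\ c' a b).
Proof.
  intros [Qs [H1 H2]] [Qs' [H1' H2']].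
  exists (map (fun q a => fst q a /\ snd q a) (list_prod Qs Qs')). split.
  - intros a Ha. destruct (H1 a Ha) as [Q [HQ HQa]]. destruct (H1' a Ha) as [Q' [HQ' HQa']].
    exists (fun a => Q a /\ Q' a). split; [|auto].
    apply in_map_iff. exists (Q, Q'). split; [reflexivity|]. apply in_prod; assumption.
  - intros Q0 HQ0. apply in_map_iff in HQ0 as [[Q Q'] [<- HQ]].
    apply in_prod_iff in HQ as [HQ HQ']. simpl. intros a b [] []. split; eauto.
Qed.

Lemma fin_cover_or {T} (P P' : T -> Prop) c :
  fin_cover P c -> fin_cover P' c -> fin_cover (fun a => P a \/ P' a) c.
Proof.
  intros [Qs [H1 H2]] [Qs' [H1' H2']]. exists (Qs ++ Qs'). split.
  - intros a [Ha|Ha]; [destruct (H1 a Ha) as [Q []]|destruct (H1' a Ha) as [Q []]];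
      exists Q; rewrite in_app_iff; auto.
  - intros Q HQ. apply in_app_iff in HQ as [HQ|HQ]; [exact (H2 Q HQ)|exact (H2' Q HQ)].
Qed.

Lemma fin_cover_preimage {S T} (g : S -> T) (P : T -> Prop) c :
  fin_cover P c -> fin_cover (fun s => P (g s)) (fun a b => c (g a) (g b)).
Proof.
  intros [Qs [H1 H2]]. exists (map (fun Q s => Q (g s)) Qs). split.
  - intros a Ha. destruct (H1 _ Ha) as [Q [HQ HQa]].
    exists (fun s => Q (g s)). split; [|assumption]. apply in_map_iff; eauto.
  - intros Q0 HQ0. apply in_map_iff in HQ0 as [Q [<- HQ]]. intros a b. apply H2, HQ.
Qed.

Lemma fin_cover_weaken {T} (P P' : T -> Prop) (c c' : T -> T -> Prop) :
  (forall a, P' a -> P a) -> (forall a b, P' a -> P' b -> c a b -> c' a b) ->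
  fin_cover P c -> fin_cover P' c'.
Proof.
  (* The pieces are cut down to [P'], where alone [c] implies [c']. *)
  intros HP Hc [Qs [H1 H2]]. exists (map (fun Q a => Q a /\ P' a) Qs). split.
  - intros a Ha. destruct (H1 a (HP a Ha)) as [Q [HQ HQa]].
    exists (fun a => Q a /\ P' a). split; [|auto]. apply in_map_iff; eauto.
  - intros Q0 HQ0. apply in_map_iff in HQ0 as [Q [<- HQ]].
    intros a b [Ha HPa] [Hb HPb]. apply Hc; auto. eapply H2; eassumption.
Qed.

Lemma fin_cover_forall_le {T} (P : T -> Prop) (c : nat -> T -> T -> Prop) n :
  (forall i, (i <= n)%nat -> fin_cover P (c i)) ->
  fin_cover P (fun a b => forall i, (i <= n)%nat -> c i a b).
Proof.
  induction n as [|n IH]; intros H.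
  - apply (fin_cover_weaken P P (c 0%nat)); auto.
    intros a b _ _ Hab i Hi. replace i with 0%nat by lia. exact Hab.
  - apply (fin_cover_weaken P P (fun a b => (forall i, (i <= n)%nat -> c i a b) /\ c (S n) a b)); auto.
    + intros a b _ _ [Hab Hab'] i Hi.
      destruct (PeanoNat.Nat.eq_dec i (S n)) as [->|]; [assumption|apply Hab; lia].
    + apply fin_cover_and; auto.
Qed.

Lemma fin_cover_interval a b h :
  0 < h -> fin_cover (fun t => a <= t <= b) (fun s t => Rabs (s - t) < h).
Proof.
  intros Hh.
  assert (H : forall m, fin_cover (fun t => a <= t <= a + INR m * (h / 2))
                              (fun s t => Rabs (s - t) < h)).
  { induction m as [|m IH].
    - exists [fun t => a <= t <= a]. split.
      + intros t Ht. simpl in Ht. exists (fun t => a <= t <= a). simpl. split; [auto|lra].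
      + intros Q [<-|[]] s t Hs Ht. apply Rabs_def1; lra.
    - assert (Hi : fin_cover (fun t => a + INR m * (h / 2) <= t <= a + INR (S m) * (h / 2))
                         (fun s t => Rabs (s - t) < h)).
      { eexists [_]. split.
        - intros t Ht. eexists. split; [left; reflexivity|exact Ht].
        - intros Q [<-|[]] s t Hs Ht. rewrite S_INR in *. apply Rabs_def1; lra. }
      eapply fin_cover_weaken; [| |exact (fin_cover_or _ _ _ IH Hi)].
      + intros t Ht. cbv beta in *. destruct (Rle_lt_dec t (a + INR m * (h / 2))); [left|right]; lra.
      + auto. }
  destruct (INR_unbounded ((b - a) / (h / 2))) as [m Hm].
  eapply fin_cover_weaken; [| |exact (H m)]; [|auto].
  intros t Ht. simpl. split; [lra|].
  apply (Rmult_lt_compat_r (h / 2)) in Hm; [|lra].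
  replace ((b - a) / (h / 2) * (h / 2)) with (b - a) in Hm by (field; lra). lra.
Qed.

(* Pigeonhole, level by level: the classes of level [m] that are hit infinitely often are
   nested, and [phi k] is picked in the class of level [k]. *)
Lemma diagonal_subsequence (close : nat -> nat -> nat -> Prop) :
  (forall m, exists N0, fin_cover (fun N => (N0 <= N)%nat) (close m)) ->
  exists phi : nat -> nat, (forall k, (k <= phi k)%nat) /\
    forall m p q, (m <= p)%nat -> (m <= q)%nat -> close m (phi p) (phi q).
Proof.
  intros H. set (inf := fun P : nat -> Prop => forall N, exists k, (N <= k)%nat /\ P k).
  assert (Hstep : forall z : nat * (nat -> Prop), exists P' : nat -> Prop,
    inf (snd z) -> inf P' /\ (forall k, P' k -> snd z k) /\
      (forall a b, P' a -> P' b -> close (fst z) a b)).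
  { intros [m P]. destruct (H m) as [N0 [Qs [H1 H2]]]. simpl.
    destruct (classic (exists Q, In Q Qs /\ inf (fun k => P k /\ Q k))) as [[Q [HQ Hi]]|Hn].
    - exists (fun k => P k /\ Q k). intros _. split; [assumption|]. split; [tauto|].
      intros a b [_ Ha] [_ Hb]. eapply H2; eassumption.
    - exists P. intros HP. exfalso.
      (* If no piece meets [P] infinitely often, then beyond some index [P] misses all of the
         finitely many pieces. *)
      assert (Hb : forall l : list (nat -> Prop), (forall Q, In Q l -> In Q Qs) ->
        exists N, forall k Q, (N <= k)%nat -> In Q l -> ~ (P k /\ Q k)).
      { induction l as [|Q l IH]; intros Hl.
        - exists 0%nat. intros k Q _ [].
        - destruct IH as [N HN]; [intros; apply Hl; right; assumption|].
          assert (HQ : ~ inf (fun k => P k /\ Q k)).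
          { intros Hi. apply Hn. exists Q. split; [apply Hl; left; reflexivity|assumption]. }
          apply not_all_ex_not in HQ as [N' HN']. exists (Nat.max N N').
          intros k Q0 Hk [<-|HQ0] HPQ; [apply HN'; exists k; split; [lia|assumption]|].
          apply (HN k Q0); auto; lia. }
      destruct (Hb Qs (fun _ h => h)) as [N HN].
      destruct (HP (Nat.max N N0)) as [k [Hk HPk]].
      destruct (H1 k ltac:(lia)) as [Q [HQ HQk]].
      apply (HN k Q); auto; lia. }
  apply choice in Hstep as [g Hg].
  set (P := nat_rect (fun _ => nat -> Prop) (fun _ => True) (fun m P => g (m, P))).
  assert (Hinf : forall m, inf (P m)).
  { induction m as [|m IH]; [intros N; exists N; split; [lia|exact I]|].
    apply (Hg (m, P m)), IH. }
  assert (Hdec : forall m k, (m <= k)%nat -> forall a, P k a -> P m a).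
  { intros m k Hk. induction Hk as [|k Hk IH]; [auto|].
    intros a Ha. apply IH. apply (Hg (k, P k) (Hinf k)), Ha. }
  (* Closeness of level [m] holds on [P (S m)], since [P 0] is everything; hence the index [S k]. *)
  destruct (choice (fun k n => (k <= n)%nat /\ P (S k) n)) as [phi Hphi].
  { intros k. apply Hinf. }
  exists phi. split; [intros k; apply Hphi|]. intros m p q Hp Hq.
  apply (Hg (m, P m) (Hinf m)).
  - apply (Hdec (S m) (S p)); [lia|apply Hphi].
  - apply (Hdec (S m) (S q)); [lia|apply Hphi].
Qed.

(** * Compactness of small balls and Arzela-Ascoli *)

Definition converges {X} (d : X -> X -> R) (u : nat -> X) (l : X) : Prop :=
  forall eps, 0 < eps -> exists N, forall p, (N <= p)%nat -> d (u p) l < eps.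

Definition totally_bounded {X} (d : X -> X -> R) (P : X -> Prop) : Prop :=
  forall eps, 0 < eps -> fin_cover P (fun a b => d a b < eps).

(** The condition [k <= phi k] expresses extraction: the selected indices tend to infinity. *)
Definition seq_compact {X} (d : X -> X -> R) (K : X -> Prop) : Prop :=
  forall u : nat -> X, (forall k, K (u k)) ->
    exists phi l, (forall k, (k <= phi k)%nat) /\ K l /\ converges d (fun k => u (phi k)) l.

Lemma closed_ball_seq_compact {X} {d : X -> X -> R} (Hd : is_metric d) x r rho :
  complete d -> r < rho -> totally_bounded d (ball d x rho) ->
  seq_compact d (fun u => d x u <= r).
Proof.
  intros Hcomp Hr Htb u Hu.
  destruct (diagonal_subsequence (fun m p q => d (u p) (u q) < / INR (S m)))
    as [phi [Hphi Hc]].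
  { intros m. exists 0%nat.
    eapply fin_cover_weaken; [| |apply (fin_cover_preimage u _ _ (Htb _ (inv_INR_S_pos m)))]; auto.
    intros k _. unfold ball. specialize (Hu k). lra. }
  destruct (Hcomp (fun k => u (phi k))) as [l Hl].
  { intros eps He. destruct (inv_INR_S_small eps He) as [N HN]. exists N. intros p q Hp Hq.
    specialize (HN N (le_n N)). specialize (Hc N p q Hp Hq). lra. }
  exists phi, l. split; [assumption|]. split; [|exact Hl].
  apply Rnot_lt_le. intros Hlt. destruct (Hl (d x l - r) ltac:(lra)) as [N HN].
  specialize (HN N (le_n N)). specialize (Hu (phi N)).
  pose proof (dist_tri Hd x (u (phi N)) l). lra.
Qed.

Lemma eucl_coord n v i : (i <= n)%nat -> Rabs (v i) <= eucl n origin v.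
Proof.
  intros Hi. unfold eucl, origin. rewrite <- sqrt_Rsqr_abs.
  apply sqrt_le_1_alt. unfold Rsqr.
  assert (Hpos : forall m, 0 <= sum_f_R0 (fun i => (0 - v i) ^ 2) m).
  { intros m. apply cond_pos_sum. intros k. apply pow2_ge_0. }
  induction n as [|n IH].
  - replace i with 0%nat by lia. simpl. nra.
  - cbn [sum_f_R0]. destruct (PeanoNat.Nat.eq_dec i (S n)) as [->|].
    + specialize (Hpos n). nra.
    + specialize (IH ltac:(lia)). pose proof (pow2_ge_0 (0 - v (S n))). lra.
Qed.

(** The sum in [eucl n] runs over the [n + 1] indices from 0 to [n], whence the factor. *)
Lemma eucl_le n u v h : 0 < h ->
  (forall i, (i <= n)%nat -> Rabs (u i - v i) < h) -> eucl n u v <= INR (S n) * h.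
Proof.
  intros Hh H. unfold eucl.
  assert (Hn : 0 <= INR (S n) * h) by (pose proof (pos_INR (S n)); nra).
  rewrite <- (sqrt_pow2 _ Hn). apply sqrt_le_1_alt.
  assert (Hs : sum_f_R0 (fun i => (u i - v i) ^ 2) n <= INR (S n) * (h * h)).
  { clear Hn. induction n as [|n IH].
    - specialize (H 0%nat (le_n _)). apply Rabs_def2 in H. simpl. nra.
    - cbn [sum_f_R0]. rewrite S_INR. assert (Hi := H (S n) (le_n _)). apply Rabs_def2 in Hi.
      assert (sum_f_R0 (fun i => (u i - v i) ^ 2) n <= INR (S n) * (h * h)) by (apply IH; auto).
      nra. }
  eapply Rle_trans; [exact Hs|]. pose proof (pos_INR n). rewrite S_INR. nra.
Qed.

Lemma chart_ball_totally_bounded n {X} (d : X -> X -> R) C Rad x :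
  1 <= C -> bilip_charts n d C Rad -> totally_bounded d (ball d x Rad).
Proof.
  intros HC Hch eps He. destruct (Hch x) as [phi [H1 [_ H3]]].
  (* Coordinates within [h] give chart images within [eps / (2 * C)], hence points within [eps / 2]
     by the lower bilipschitz bound. *)
  set (h := eps / (2 * C * INR (S n))).
  pose proof (lt_0_INR (S n) ltac:(lia)) as Hn.
  assert (Hh : 0 < h) by (apply Rdiv_lt_0_compat; nra).
  eapply fin_cover_weaken with (P := ball d x Rad)
    (c := fun a b => forall i, (i <= n)%nat -> Rabs (phi a i - phi b i) < h); auto.
  - intros a b Ha Hb Hab. apply eucl_le in Hab; [|assumption].
    destruct (H3 a b Ha Hb) as [H4 _].
    assert (Hlt : / C * d a b <= / C * (eps / 2)).
    { eapply Rle_trans; [exact H4|]. eapply Rle_trans; [exact Hab|].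
      right. unfold h. field. lra. }
    apply Rmult_le_reg_l in Hlt; [lra|]. apply Rinv_0_lt_compat; lra.
  - apply fin_cover_forall_le. intros i Hi.
    eapply fin_cover_weaken;
      [| |exact (fin_cover_preimage (fun a => phi a i) _ _ (fin_cover_interval (- Rad) Rad h Hh))];
      auto.
    intros a Ha. simpl. destruct (H1 a Ha) as [_ H4].
    pose proof (eucl_coord n (phi a) i Hi) as H5.
    pose proof (Rle_abs (phi a i)). pose proof (Rle_abs (- phi a i)).
    rewrite Rabs_Ropp in *. lra.
Qed.

Lemma nat_floor r : 0 <= r -> exists k, INR k <= r < INR k + 1.
Proof.
  intros Hr. destruct (INR_unbounded r) as [m Hm].
  induction m as [|m IH]; [simpl in Hm; lra|].
  destruct (Rle_lt_dec (INR m) r); [|auto]. exists m. rewrite S_INR in Hm. lra.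
Qed.

Lemma grid_point M t : (0 < M)%nat -> 0 <= t <= 1 ->
  exists i, (i <= M)%nat /\ INR i / INR M <= t < INR i / INR M + / INR M.
Proof.
  intros HM Ht. pose proof (lt_0_INR M HM) as HM'.
  destruct (nat_floor (t * INR M)) as [i Hi]; [nra|].
  exists i. split; [apply INR_le; nra|].
  split; apply (Rmult_le_reg_r (INR M)) || apply (Rmult_lt_reg_r (INR M)); try assumption.
  - unfold Rdiv. rewrite Rmult_assoc, Rinv_l; lra.
  - unfold Rdiv. rewrite Rmult_plus_distr_r, Rmult_assoc, Rinv_l; lra.
Qed.

Lemma grid_bounds M i : (0 < M)%nat -> (i <= M)%nat -> 0 <= INR i / INR M <= 1.
Proof.
  intros HM Hi. pose proof (lt_0_INR M HM) as HM'. apply le_INR in Hi.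
  pose proof (pos_INR i). split.
  - apply Rmult_le_pos; [assumption|]. left. apply Rinv_0_lt_compat, HM'.
  - apply (Rmult_le_reg_r (INR M)); [assumption|].
    unfold Rdiv. rewrite Rmult_assoc, Rinv_l; lra.
Qed.

(* Arzela-Ascoli for functions that need not be continuous but whose oscillation at every
   scale is eventually controlled, as is the case for step functions with finer and finer
   steps. *)
Lemma arzela_ascoli {X} {d : X -> X -> R} (Hd : is_metric d) (P : X -> Prop) (U : nat -> R -> X) :
  complete d -> totally_bounded d P ->
  (forall N t, 0 <= t <= 1 -> P (U N t)) ->
  (forall eps, 0 < eps -> exists delta N0, 0 < delta /\ forall N s t, (N0 <= N)%nat ->
     0 <= s <= 1 -> 0 <= t <= 1 -> Rabs (s - t) < delta -> d (U N s) (U N t) < eps) ->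
  exists phi b, (forall k, (k <= phi k)%nat) /\ is_path d b /\
    forall t, 0 <= t <= 1 -> converges d (fun k => U (phi k) t) (b t).
Proof.
  intros Hcomp Htb HP Heq.
  destruct (diagonal_subsequence (fun m p q =>
    forall t, 0 <= t <= 1 -> d (U p t) (U q t) < / INR (S m))) as [phi [Hphi Hc]].
  { intros m. pose proof (inv_INR_S_pos m) as Hm.
    set (eps := / INR (S m) / 3). assert (He : 0 < eps) by (unfold eps; lra).
    destruct (Heq eps He) as [dl [N0 [Hdl Hosc]]]. exists N0.
    destruct (archimed_cor1 dl Hdl) as [M [HM HM0]].
    (* Indices are classified by the pieces containing their values at the grid times; from [N0] on,
       the oscillation bound extends closeness to all times. *)
    eapply fin_cover_weaken with (P := fun _ => True)
      (c := fun p q => forall i, (i <= M)%nat -> d (U p (INR i / INR M)) (U q (INR i / INR M)) < eps);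
      auto.
    - intros p q Hp Hq Hpq t Ht. destruct (grid_point M t HM0 Ht) as [i [Hi Hti]].
      pose proof (grid_bounds M i HM0 Hi) as Hg. set (g := INR i / INR M) in *.
      assert (d (U p t) (U p g) < eps) by (apply Hosc; auto; apply Rabs_def1; lra).
      assert (d (U q g) (U q t) < eps) by (apply Hosc; auto; apply Rabs_def1; lra).
      specialize (Hpq i Hi). fold g in Hpq.
      pose proof (dist_tri Hd (U p t) (U p g) (U q t)).
      pose proof (dist_tri Hd (U p g) (U q g) (U q t)). unfold eps in *. lra.
    - apply fin_cover_forall_le. intros i Hi.
      eapply fin_cover_weaken;
        [| |exact (fin_cover_preimage (fun p => U p (INR i / INR M)) _ _ (Htb eps He))]; auto.
      intros p _. apply HP, grid_bounds; assumption. }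
  destruct (choice (fun t l => 0 <= t <= 1 -> converges d (fun k => U (phi k) t) l)) as [b Hb].
  { intros t. destruct (classic (0 <= t <= 1)) as [Ht|Ht].
    - destruct (Hcomp (fun k => U (phi k) t)) as [l Hl].
      + intros eps He. destruct (inv_INR_S_small eps He) as [N HN]. exists N. intros p q Hp Hq.
        specialize (HN N (le_n N)). specialize (Hc N p q Hp Hq t Ht). lra.
      + exists l. intros _. exact Hl.
    (* An arbitrary value outside [0,1]. *)
    - exists (U 0%nat t). tauto. }
  exists phi, b. split; [assumption|]. split; [|assumption].
  intros t Ht eps He. destruct (Heq (eps / 3) ltac:(lra)) as [dl [N0 [Hdl Hosc]]].
  exists dl. split; [assumption|]. intros s Hs Hst.
  destruct (Hb t Ht (eps / 3) ltac:(lra)) as [N1 HN1].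
  destruct (Hb s Hs (eps / 3) ltac:(lra)) as [N2 HN2].
  set (k := (N0 + N1 + N2)%nat).
  specialize (HN1 k ltac:(lia)). specialize (HN2 k ltac:(lia)). simpl in HN1, HN2.
  assert (d (U (phi k) s) (U (phi k) t) < eps / 3).
  { apply Hosc; auto. specialize (Hphi k). lia. }
  rewrite (dist_sym Hd (U (phi k) s) (b s)) in HN2.
  pose proof (dist_tri Hd (b s) (U (phi k) s) (b t)).
  pose proof (dist_tri Hd (U (phi k) s) (U (phi k) t) (b t)). lra.
Qed.

Lemma converges_map {X Y} {dX : X -> X -> R} {dY : Y -> Y -> R}
  (HdX : is_metric dX) (HdY : is_metric dY) (f : X -> Y) u l :
  continuous_map dX dY f -> converges dX u l -> converges dY (fun k => f (u k)) (f l).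
Proof.
  intros Hf Hu eps He. destruct (Hf l eps He) as [dl [Hdl H]].
  destruct (Hu dl Hdl) as [N HN]. exists N. intros p Hp.
  rewrite (dist_sym HdY). apply H. rewrite (dist_sym HdX). auto.
Qed.

(** * Local lifting of paths along discrete open maps *)

Section LocalLifting.
Context {X Y : Type} {dX : X -> X -> R} {dY : Y -> Y -> R}.
Context (HdX : is_metric dX) (HdY : is_metric dY) {f : X -> Y}.
Context (Hf : continuous_map dX dY f).

(** Otherwise points of the annulus with images tending to [y] would accumulate at a point of the
    closed annulus over [y]. The case [a = b] of a sphere is used too. *)
Lemma annulus_gap K s y a b : seq_compact dX K ->
  (forall v, K v -> a <= dX s v <= b -> f v <> y) ->
  exists eta, 0 < eta /\ forall v, K v -> a <= dX s v <= b -> eta <= dY y (f v).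
Proof.
  intros HK Hno. apply NNPP. intros Hn.
  assert (Hv : forall k : nat, exists v, K v /\ a <= dX s v <= b /\ dY y (f v) < / INR (S k)).
  { intros k. apply NNPP. intros Hk. apply Hn. exists (/ INR (S k)).
    split; [apply inv_INR_S_pos|]. intros v HKv Hsv. apply Rnot_lt_le. intros Hlt.
    apply Hk. eauto. }
  apply choice in Hv as [v Hv].
  destruct (HK v (fun k => proj1 (Hv k))) as [phi [l [Hphi [HKl Hl]]]].
  assert (Hal : a <= dX s l <= b).
  { split; apply Rnot_lt_le; intros Hlt.
    - destruct (Hl (a - dX s l) ltac:(lra)) as [N HN]. specialize (HN N (le_n N)).
      destruct (Hv (phi N)) as [_ [Ha _]].
      pose proof (dist_tri HdX s l (v (phi N))). rewrite (dist_sym HdX l) in *. lra.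
    - destruct (Hl (dX s l - b) ltac:(lra)) as [N HN]. specialize (HN N (le_n N)).
      destruct (Hv (phi N)) as [_ [Ha _]].
      pose proof (dist_tri HdX s (v (phi N)) l). lra. }
  apply (Hno l HKl Hal). symmetry. apply (dist_eq0 HdY).
  apply Rle_antisym; [|apply (dist_ge0 HdY)]. apply Rnot_lt_le. intros Hlt.
  destruct (converges_map HdX HdY f _ _ Hf Hl (dY y (f l) / 2) ltac:(lra)) as [N HN].
  destruct (inv_INR_S_small (dY y (f l) / 2) ltac:(lra)) as [N' HN'].
  specialize (HN (N + N')%nat ltac:(lia)). simpl in HN.
  specialize (Hphi (N + N')%nat). specialize (HN' (phi (N + N')%nat) ltac:(lia)).
  destruct (Hv (phi (N + N')%nat)) as [_ [_ Hy]].
  pose proof (dist_tri HdY y (f (v (phi (N + N')%nat))) (f l)). lra.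
Qed.

(** Steps shorter than [eta] cannot jump over a shell of thickness [eta]. *)
Lemma chain_crossing (s : X) (w : nat -> X) a eta i j : (i <= j)%nat ->
  (forall m, (i <= m < j)%nat -> dX (w m) (w (S m)) < eta) ->
  dX s (w i) < a -> a <= dX s (w j) ->
  exists m, (i <= m <= j)%nat /\ a <= dX s (w m) <= a + eta.
Proof.
  intros Hij. induction Hij as [|j Hij IH]; intros Hw Hi Hj; [lra|].
  destruct (Rle_lt_dec a (dX s (w j))) as [Hle|Hlt].
  - destruct IH as [m [Hm H]]; try assumption; [intros m Hm; apply Hw; lia|].
    exists m. split; [lia|assumption].
  - exists (S j). split; [lia|]. specialize (Hw j ltac:(lia)).
    pose proof (dist_tri HdX s (w j) (w (S j))). lra.
Qed.

(* A fine chain with long extent and small image would cross a thin annulus around a limit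
   of its starting points, and the annulus contains no point of the limit fibre. *)
Lemma light_chains K : seq_compact dX K -> discrete_map dX f ->
  forall eps, 0 < eps -> exists eta, 0 < eta /\
    forall (w : nat -> X) i j, (i <= j)%nat ->
      (forall m, (i <= m <= j)%nat -> K (w m) /\ dY (f (w i)) (f (w m)) < eta) ->
      (forall m, (i <= m < j)%nat -> dX (w m) (w (S m)) < eta) ->
      dX (w i) (w j) < eps.
Proof.
  intros HK Hdisc eps He. apply NNPP. intros Hn.
  assert (Hs : forall k : nat, exists s, K s /\ exists (w : nat -> X) i j, (i <= j)%nat /\ w i = s /\
      (forall m, (i <= m <= j)%nat -> K (w m) /\ dY (f s) (f (w m)) < / INR (S k)) /\
      (forall m, (i <= m < j)%nat -> dX (w m) (w (S m)) < / INR (S k)) /\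
      eps <= dX s (w j)).
  { intros k. apply NNPP. intros Hk. apply Hn. exists (/ INR (S k)).
    split; [apply inv_INR_S_pos|]. intros w i j Hij H1 H2. apply Rnot_le_lt. intros Hle.
    apply Hk. exists (w i). split; [apply H1; lia|]. exists w, i, j. auto. }
  apply choice in Hs as [s Hs].
  destruct (HK s (fun k => proj1 (Hs k))) as [phi [l [Hphi [HKl Hl]]]].
  destruct (Hdisc l) as [r [Hr Hfib]].
  (* The annulus between [a] and [2 * a] about [l] lies within the radius of discreteness. A chain
     starting within [a] of [l] and ending at least [eps] from its start ends beyond [a]. *)
  set (a := Rmin r eps / 4).
  assert (Ha : 0 < a) by (unfold a; pose proof (Rmin_pos r eps Hr He); lra).
  assert (Har : 4 * a <= r /\ 4 * a <= eps).
  { unfold a. pose proof (Rmin_l r eps). pose proof (Rmin_r r eps). lra. }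
  destruct (annulus_gap K l (f l) a (2 * a) HK) as [eta [Heta Hgap]].
  { intros v _ Hv E. assert (v = l) by (apply Hfib; [lra|assumption]). subst v.
    rewrite (dist_refl HdX) in Hv. lra. }
  destruct (Hl a Ha) as [N1 HN1].
  destruct (converges_map HdX HdY f _ _ Hf Hl (eta / 2) ltac:(lra)) as [N2 HN2].
  destruct (inv_INR_S_small (Rmin a (eta / 2))) as [N3 HN3]; [apply Rmin_pos; lra|].
  set (k := (N1 + N2 + N3)%nat).
  specialize (HN1 k ltac:(lia)). specialize (HN2 k ltac:(lia)). simpl in HN1, HN2.
  specialize (HN3 (phi k) ltac:(specialize (Hphi k); lia)).
  pose proof (Rmin_l a (eta / 2)). pose proof (Rmin_r a (eta / 2)).
  destruct (Hs (phi k)) as [HKs [w [i [j [Hij [Hwi [Hw1 [Hw2 Hw3]]]]]]]].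
  rewrite (dist_sym HdX) in HN1. rewrite (dist_sym HdY) in HN2.
  destruct (chain_crossing l w a (/ INR (S (phi k))) i j Hij Hw2) as [m [Hm Hlm]].
  { rewrite Hwi. exact HN1. }
  { pose proof (dist_tri HdX (s (phi k)) l (w j)). rewrite (dist_sym HdX (s (phi k)) l) in *. lra. }
  destruct (Hw1 m Hm) as [HKm Hfm].
  (* Yet [f (w m)] is within [eta / 2] of the image of the start, itself within [eta / 2] of
     [f l]. *)
  assert (Hge : eta <= dY (f l) (f (w m))) by (apply Hgap; [assumption|lra]).
  pose proof (dist_tri HdY (f l) (f (s (phi k))) (f (w m))). lra.
Qed.

(** Points violating this at smaller and smaller [rho] would accumulate at some [l], which the third
    hypothesis keeps off the sphere of radius [r]; openness at [l] then provides the missing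
    preimages. *)
Lemma uniformly_open x r sigma :
  open_map dX dY f -> seq_compact dX (fun u => dX x u <= r) ->
  (forall u, dX x u <= r -> dY (f x) (f u) <= sigma -> dX x u < r) ->
  forall eta, 0 < eta -> exists rho, 0 < rho /\
    forall u y, dX x u <= r -> dY (f x) (f u) <= sigma -> dY (f u) y < rho ->
      exists v, f v = y /\ dX x v <= r /\ dX u v < eta.
Proof.
  intros Hopen HK Hin eta Heta. apply NNPP. intros Hn.
  assert (Hu : forall k : nat, exists u, dX x u <= r /\ exists y, dY (f x) (f u) <= sigma /\
     dY (f u) y < / INR (S k) /\ ~ exists v, f v = y /\ dX x v <= r /\ dX u v < eta).
  { intros k. apply NNPP. intros Hk. apply Hn. exists (/ INR (S k)).
    split; [apply inv_INR_S_pos|]. intros u y H1 H2 H3. apply NNPP. intros H4.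
    apply Hk. exists u. split; [assumption|]. exists y. auto. }
  apply choice in Hu as [u Hu].
  destruct (HK u (fun k => proj1 (Hu k))) as [phi [l [Hphi [HKl Hl]]]].
  pose proof (converges_map HdX HdY f _ _ Hf Hl) as Hfl.
  assert (Hlr : dX x l < r).
  { apply Hin; [assumption|]. apply Rnot_lt_le. intros Hlt.
    destruct (Hfl (dY (f x) (f l) - sigma) ltac:(lra)) as [N HN].
    specialize (HN N (le_n N)). simpl in HN. destruct (Hu (phi N)) as [_ [y [H _]]].
    pose proof (dist_tri HdY (f x) (f (u (phi N))) (f l)). lra. }
  (* Small enough for the preimage to be within [eta] of [u] and to stay in the ball about [x]. *)
  set (r' := Rmin (eta / 2) (r - dX x l)).
  assert (Hr' : 0 < r') by (apply Rmin_pos; lra).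
  assert (Hr1 : r' <= eta / 2) by apply Rmin_l.
  assert (Hr2 : r' <= r - dX x l) by apply Rmin_r.
  destruct (Hopen (ball dX l r')) with (x := f l) as [tau [Htau Hball]].
  { intros z Hz. unfold ball in *. exists (r' - dX l z). split; [lra|]. intros z' Hz'.
    pose proof (dist_tri HdX l z z'). lra. }
  { exists l. split; [|reflexivity]. unfold ball. rewrite (dist_refl HdX). assumption. }
  destruct (Hl (eta / 2) ltac:(lra)) as [N1 HN1].
  destruct (Hfl (tau / 2) ltac:(lra)) as [N2 HN2].
  destruct (inv_INR_S_small (tau / 2) ltac:(lra)) as [N3 HN3].
  set (k := (N1 + N2 + N3)%nat).
  specialize (HN1 k ltac:(lia)). specialize (HN2 k ltac:(lia)). simpl in HN1, HN2.
  specialize (HN3 (phi k) ltac:(specialize (Hphi k); lia)).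
  destruct (Hu (phi k)) as [_ [y [_ [Hy Hno]]]]. apply Hno.
  destruct (Hball y) as [v [Hv E]].
  { unfold ball. pose proof (dist_tri HdY (f l) (f (u (phi k))) y).
    rewrite (dist_sym HdY (f l) (f (u (phi k)))) in *. lra. }
  unfold ball in Hv. exists v. split; [assumption|].
  pose proof (dist_tri HdX x l v). pose proof (dist_tri HdX (u (phi k)) l v). lra.
Qed.

(* A step function through points of the fibres over a fine grid of times, each within [eta]
   of the preceding one. *)
Lemma coarse_lift x r sigma g :
  open_map dX dY f -> seq_compact dX (fun u => dX x u <= r) -> 0 <= r ->
  (forall u, dX x u <= r -> dY (f x) (f u) <= sigma -> dX x u < r) ->
  is_path dY g -> g 0 = f x -> (forall t, 0 <= t <= 1 -> dY (f x) (g t) <= sigma) ->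
  forall eta, 0 < eta -> exists U : R -> X, U 0 = x /\
    (forall t, 0 <= t <= 1 -> dX x (U t) <= r /\
       exists tau, 0 <= tau <= 1 /\ t - eta < tau <= t /\ f (U t) = g tau) /\
    forall s t, 0 <= s <= t -> t <= 1 -> exists (w : nat -> X) i j,
      (i <= j)%nat /\ w i = U s /\ w j = U t /\
      (forall m, (i <= m <= j)%nat -> dX x (w m) <= r /\
         exists tau, 0 <= tau <= 1 /\ s - eta < tau <= t /\ f (w m) = g tau) /\
      (forall m, (i <= m < j)%nat -> dX (w m) (w (S m)) < eta).
Proof.
  intros Hopen HK Hr Hin Hg Hg0 Hgs eta Heta.
  destruct (uniformly_open x r sigma Hopen HK Hin eta Heta) as [rho [Hrho Hstep]].
  destruct (path_uniform HdY g Hg rho Hrho) as [dl [Hdl Huni]].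
  (* A mesh below [dl] makes consecutive values of [g] closer than [rho]; a mesh below [eta] bounds
     the delay of the step function. *)
  destruct (archimed_cor1 (Rmin dl eta)) as [M [HM HM0]]; [apply Rmin_pos; assumption|].
  pose proof (Rmin_l dl eta). pose proof (Rmin_r dl eta).
  pose proof (lt_0_INR M HM0) as HM'.
  set (T := fun i => INR i / INR M).
  assert (HT : forall i, (i <= M)%nat -> 0 <= T i <= 1) by (intros; apply grid_bounds; assumption).
  assert (HTS : forall i, T (S i) = T i + / INR M).
  { intros i. unfold T. rewrite S_INR. field. lra. }
  (* The conditions are premises inside the existential, so that [choice] yields a total function;
     where they fail, [u] is the default. *)
  assert (Hex : forall z : nat * X, exists v, (fst z < M)%nat -> dX x (snd z) <= r ->
     f (snd z) = g (T (fst z)) ->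
     dX x v <= r /\ f v = g (T (S (fst z))) /\ dX (snd z) v < eta).
  { intros [i u]. simpl. destruct (classic ((i < M)%nat /\ dX x u <= r /\ f u = g (T i)))
      as [[Hi [Hu E]]|Hn].
    - destruct (Hstep u (g (T (S i)))) as [v [H1 [H2 H3]]]; try assumption.
      + rewrite E. apply Hgs, HT. lia.
      + rewrite E. apply Huni; try (apply HT; lia). rewrite HTS.
        pose proof (Rinv_0_lt_compat _ HM'). apply Rabs_def1; lra.
      + exists v. auto.
    - exists u. tauto. }
  apply choice in Hex as [next Hnext].
  set (W := nat_rect (fun _ => X) x (fun i u => next (i, u))).
  assert (HW : forall i, (i <= M)%nat -> dX x (W i) <= r /\ f (W i) = g (T i)).
  { induction i as [|i IH]; intros Hi.
    - simpl. rewrite (dist_refl HdX). unfold T. simpl.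
      replace (0 / INR M) with 0 by (unfold Rdiv; ring). auto.
    - destruct (IH ltac:(lia)) as [H1 H2].
      destruct (Hnext (i, W i) ltac:(simpl; lia) H1 H2) as [H3 [H4 _]]. auto. }
  assert (HWs : forall i, (i < M)%nat -> dX (W i) (W (S i)) < eta).
  { intros i Hi. destruct (HW i ltac:(lia)) as [H1 H2].
    apply (Hnext (i, W i)); assumption. }
  destruct (choice (fun t i => 0 <= t <= 1 -> (i <= M)%nat /\ T i <= t < T i + / INR M))
    as [I HI].
  { intros t. destruct (classic (0 <= t <= 1)) as [Ht|Ht].
    - destruct (grid_point M t HM0 Ht) as [i Hi]. exists i. auto.
    - exists 0%nat. tauto. }
  assert (HTmono : forall i j, T i < T j + / INR M -> (i <= j)%nat).
  { intros i j Hij. rewrite <- HTS in Hij. unfold T, Rdiv in Hij.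
    apply Rmult_lt_reg_r in Hij; [|apply Rinv_0_lt_compat, HM']. apply INR_lt in Hij. lia. }
  exists (fun t => W (I t)). split; [|split].
  - destruct (HI 0 ltac:(lra)) as [H1 H2].
    assert (HI0 : (I 0%R <= 0)%nat).
    { apply HTmono. replace (T 0%nat) with 0 by (unfold T, Rdiv; simpl; ring).
      pose proof (Rinv_0_lt_compat _ HM'). lra. }
    replace (I 0) with 0%nat by lia. reflexivity.
  - intros t Ht. destruct (HI t Ht) as [H1 H2]. destruct (HW _ H1) as [H3 H4].
    split; [assumption|]. exists (T (I t)). split; [apply HT, H1|]. split; [lra|assumption].
  - intros s t Hs Ht. destruct (HI s ltac:(lra)) as [H1 H2].
    destruct (HI t ltac:(lra)) as [H3 H4].
    exists W, (I s), (I t). split; [apply HTmono; lra|].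
    split; [reflexivity|]. split; [reflexivity|]. split.
    + intros m Hm. destruct (HW m ltac:(lia)) as [H5 H6]. split; [assumption|].
      exists (T m). split; [apply HT; lia|]. split; [|assumption].
      assert (Hmono : forall i j, (i <= j)%nat -> T i <= T j).
      { intros i j Hij. unfold T, Rdiv. apply Rmult_le_compat_r; [left; apply Rinv_0_lt_compat, HM'|].
        apply le_INR, Hij. }
      pose proof (Hmono (I s) m ltac:(lia)). pose proof (Hmono m (I t) ltac:(lia)). lra.
    + intros m Hm. apply HWs. lia.
Qed.

Theorem local_path_lifting x rho :
  open_map dX dY f -> discrete_map dX f -> complete dX ->
  0 < rho -> totally_bounded dX (ball dX x rho) ->
  exists sigma, 0 < sigma /\
    forall g, is_path dY g -> g 0 = f x -> (forall t, 0 <= t <= 1 -> dY (f x) (g t) <= sigma) ->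
      exists b, is_path dX b /\ b 0 = x /\ forall t, 0 <= t <= 1 -> f (b t) = g t.
Proof.
  intros Hopen Hdisc Hcomp Hrho Htb.
  destruct (Hdisc x) as [rd [Hrd Hfib]].
  set (r := Rmin rho rd / 2).
  assert (Hr : 0 < r) by (unfold r; pose proof (Rmin_pos rho rd Hrho Hrd); lra).
  assert (Hr' : r < rho /\ r < rd).
  { unfold r in *. pose proof (Rmin_l rho rd). pose proof (Rmin_r rho rd). lra. }
  pose proof (closed_ball_seq_compact HdX x r rho Hcomp ltac:(lra) Htb) as HK.
  (* The sphere of radius [r] misses the fibre of [f x], so its image stays [s0] away from [f x]: a
     lift of a path that stays within [s0 / 2] cannot reach it. *)
  destruct (annulus_gap _ x (f x) r r HK) as [s0 [Hs0 Hgap]].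
  { intros v _ Hv E. assert (v = x) by (apply Hfib; [lra|assumption]). subst v.
    rewrite (dist_refl HdX) in Hv. lra. }
  set (sigma := s0 / 2).
  assert (Hin : forall u, dX x u <= r -> dY (f x) (f u) <= sigma -> dX x u < r).
  { intros u Hu Hfu. destruct (Rle_lt_dec r (dX x u)); [|assumption].
    specialize (Hgap u Hu ltac:(lra)). unfold sigma in Hfu. lra. }
  exists sigma. split; [unfold sigma; lra|]. intros g Hg Hg0 Hgs.
  pose proof (fun N => coarse_lift x r sigma g Hopen HK ltac:(lra) Hin Hg Hg0 Hgs
    (/ INR (S N)) (inv_INR_S_pos N)) as HU.
  apply choice in HU as [U HU].
  destruct (arzela_ascoli HdX (ball dX x rho) U Hcomp Htb) as [phi [b [Hphi [Hb Hlim]]]].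
  { intros N t Ht. destruct (HU N) as [_ [H _]]. destruct (H t Ht) as [H1 _].
    unfold ball. lra. }
  { intros eps He. destruct (light_chains _ HK Hdisc eps He) as [eta [Heta Hch]].
    destruct (path_uniform HdY g Hg eta Heta) as [dl [Hdl Huni]].
    destruct (inv_INR_S_small (Rmin eta (dl / 2))) as [N0 HN0]; [apply Rmin_pos; lra|].
    pose proof (Rmin_l eta (dl / 2)). pose proof (Rmin_r eta (dl / 2)).
    exists (dl / 2), N0. split; [lra|].
    (* All fibre times of the chain lie between [s - dl / 2] and [t], an interval shorter than [dl],
       so the image of the chain is small. *)
    assert (Hst : forall N s t, (N0 <= N)%nat -> 0 <= s <= t -> t <= 1 -> t - s < dl / 2 ->
       dX (U N s) (U N t) < eps).
    { intros N s t HN Hs Ht Hts. destruct (HU N) as [_ [_ H1]].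
      destruct (H1 s t Hs Ht) as [w [i [j [Hij [<- [<- [Hw1 Hw2]]]]]]].
      specialize (HN0 N HN). apply Hch; [assumption| |].
      - intros m Hm. destruct (Hw1 m Hm) as [H2 [tm [Htm [Htm' ->]]]].
        destruct (Hw1 i ltac:(lia)) as [_ [ti [Hti [Hti' ->]]]].
        split; [assumption|]. apply Huni; try assumption. apply Rabs_def1; lra.
      - intros m Hm. specialize (Hw2 m Hm). lra. }
    intros N s t HN Hs Ht Hst'. apply Rabs_def2 in Hst'.
    destruct (Rle_lt_dec s t).
    - apply Hst; auto; lra.
    - rewrite (dist_sym HdX). apply Hst; auto; lra. }
  assert (Huniq : forall t v, 0 <= t <= 1 ->
    (forall eps, 0 < eps -> exists N, forall k, (N <= k)%nat -> dY (f (U k t)) v < eps) -> f (b t) = v).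
  { intros t v Ht Hv. apply (dist_eq0 HdY).
    apply Rle_antisym; [|apply (dist_ge0 HdY)]. apply Rnot_lt_le. intros Hlt.
    destruct (converges_map HdX HdY f _ _ Hf (Hlim t Ht) (dY (f (b t)) v / 2) ltac:(lra)) as [N1 HN1].
    destruct (Hv (dY (f (b t)) v / 2) ltac:(lra)) as [N2 HN2].
    specialize (HN1 (N1 + N2)%nat ltac:(lia)). simpl in HN1.
    specialize (HN2 (phi (N1 + N2)%nat) ltac:(specialize (Hphi (N1 + N2)%nat); lia)).
    rewrite (dist_sym HdY) in HN1.
    pose proof (dist_tri HdY (f (b t)) (f (U (phi (N1 + N2)%nat) t)) v). lra. }
  exists b. split; [assumption|]. split.
  - apply (dist_eq0 HdX). apply Rle_antisym; [|apply (dist_ge0 HdX)].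
    apply Rnot_lt_le. intros Hlt.
    destruct (Hlim 0 ltac:(lra) _ Hlt) as [N HN]. specialize (HN N (le_n N)). simpl in HN.
    destruct (HU (phi N)) as [E _]. rewrite E, (dist_sym HdX) in HN. lra.
  - intros t Ht. apply Huniq; [assumption|]. intros eps He.
    destruct (path_uniform HdY g Hg eps He) as [dl [Hdl Huni]].
    destruct (inv_INR_S_small dl Hdl) as [N HN]. exists N. intros k Hk. specialize (HN k Hk).
    destruct (HU k) as [_ [H _]]. destruct (H t Ht) as [_ [tau [H1 [H2 ->]]]].
    apply Huni; try assumption. apply Rabs_def1; lra.
Qed.
End LocalLifting.

Lemma ekeland {X} {d : X -> X -> R} (Hd : is_metric d) (phi : X -> R) K x :
  complete d -> 0 < K -> (forall u, 0 <= phi u) ->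
  (forall u eps, 0 < eps -> exists delta, 0 < delta /\
     forall v, d u v < delta -> Rabs (phi v - phi u) < eps) ->
  exists u, d x u <= K * (phi x - phi u) /\
    forall v, d u v <= K * (phi u - phi v) -> v = u.
Proof.
  intros Hcomp HK Hpos Hcont.
  set (dom := fun u v => d u v <= K * (phi u - phi v)).
  assert (Hrefl : forall u, dom u u).
  { intros u. unfold dom. rewrite (dist_refl Hd). lra. }
  assert (Htr : forall u v w, dom u v -> dom v w -> dom u w).
  { unfold dom. intros u v w H1 H2. pose proof (dist_tri Hd u v w). lra. }
  assert (Hnext : forall z : nat * X, exists v, dom (snd z) v /\
    forall w, dom (snd z) w -> phi v <= phi w + / INR (S (fst z))).
  { intros [k u]. simpl fst; simpl snd. pose proof (inv_INR_S_pos k) as Hk.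
    destruct (completeness (fun y => exists v, dom u v /\ y = - phi v)) as [m [Hub Hlub]].
    - exists 0. intros y [v [_ ->]]. specialize (Hpos v). lra.
    - exists (- phi u), u. auto.
    - apply NNPP. intros Hn. assert (m <= m - / INR (S k)); [|lra].
      apply Hlub. intros y [v [Hv ->]]. apply Rnot_lt_le. intros Hlt.
      apply Hn. exists v. split; [assumption|]. intros w Hw.
      assert (- phi w <= m) by (apply Hub; eauto). lra. }
  apply choice in Hnext as [next Hnext].
  set (u := nat_rect (fun _ => X) x (fun k v => next (k, v))).
  assert (Hmono : forall p q, (p <= q)%nat -> dom (u p) (u q)).
  { intros p q Hpq. induction Hpq as [|q Hpq IH]; [apply Hrefl|].
    apply (Htr _ _ _ IH), (Hnext (q, u q)). }
  assert (Happrox : forall k w, dom (u k) w -> phi (u (S k)) <= phi w + / INR (S k)).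
  { intros k. apply (Hnext (k, u k)). }
  destruct (Hcomp u) as [l Hl].
  { intros eps He. destruct (inv_INR_S_small (eps / (2 * K))) as [N HN].
    { apply Rdiv_lt_0_compat; lra. }
    exists (S N). specialize (HN N (le_n N)).
    assert (HKN : K * / INR (S N) < eps / 2).
    { apply (Rmult_lt_compat_l K) in HN; [|assumption].
      replace (K * (eps / (2 * K))) with (eps / 2) in HN by (field; lra). exact HN. }
    assert (H : forall q, (S N <= q)%nat -> d (u (S N)) (u q) < eps / 2).
    { intros q Hq. pose proof (Hmono _ _ Hq) as H1. unfold dom in H1.
      assert (H2 : phi (u (S N)) <= phi (u q) + / INR (S N)) by (apply Happrox, Hmono; lia).
      eapply Rle_lt_trans; [exact H1|]. eapply Rle_lt_trans; [|exact HKN].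
      apply Rmult_le_compat_l; lra. }
    intros p q Hp Hq. pose proof (H p Hp) as H1. pose proof (H q Hq).
    rewrite (dist_sym Hd) in H1. pose proof (dist_tri Hd (u p) (u (S N)) (u q)). lra. }
  assert (Hphil : forall eps, 0 < eps -> exists N, forall k, (N <= k)%nat ->
    d (u k) l < eps /\ Rabs (phi (u k) - phi l) < eps).
  { intros eps He. destruct (Hcont l eps He) as [dl [Hdl H]].
    destruct (Hl (Rmin dl eps)) as [N HN]; [apply Rmin_pos; assumption|].
    pose proof (Rmin_l dl eps). pose proof (Rmin_r dl eps).
    exists N. intros k Hk. specialize (HN k Hk). split; [lra|].
    apply H. rewrite (dist_sym Hd). lra. }
  assert (Hsl : forall k, dom (u k) l).
  { intros k. unfold dom. apply Rnot_lt_le. intros Hlt.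
    set (e := d (u k) l - K * (phi (u k) - phi l)). assert (He : 0 < e) by (unfold e; lra).
    destruct (Hphil (e / (1 + K))) as [N HN]; [apply Rdiv_lt_0_compat; lra|].
    destruct (HN (N + k)%nat ltac:(lia)) as [H1 H2]. apply Rabs_def2 in H2.
    pose proof (Hmono k (N + k)%nat ltac:(lia)) as H3. unfold dom in H3.
    pose proof (dist_tri Hd (u k) (u (N + k)%nat) l).
    assert ((1 + K) * (e / (1 + K)) = e) by (field; lra).
    assert (K * (phi l - phi (u (N + k)%nat)) <= K * (e / (1 + K))).
    { apply Rmult_le_compat_l; lra. }
    unfold e in *. lra. }
  exists l. split; [apply (Hsl 0%nat)|]. intros v Hv.
  symmetry. apply (dist_eq0 Hd). apply Rle_antisym; [|apply (dist_ge0 Hd)].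
  assert (Hlv : phi l <= phi v).
  { apply Rnot_lt_le. intros Hlt.
    destruct (inv_INR_S_small ((phi l - phi v) / 2) ltac:(lra)) as [N1 HN1].
    destruct (Hphil ((phi l - phi v) / 2) ltac:(lra)) as [N2 HN2].
    destruct (HN2 (S (N1 + N2)) ltac:(lia)) as [_ H2]. apply Rabs_def2 in H2.
    specialize (HN1 (N1 + N2)%nat ltac:(lia)).
    pose proof (Happrox (N1 + N2)%nat v (Htr _ _ _ (Hsl _) Hv)). lra. }
  assert (K * (phi l - phi v) <= 0); [|lra]. nra.
Qed.

Section FromBLD.
Context {X Y : Type} {dX : X -> X -> R} {dY : Y -> Y -> R}.
Context (HdX : is_metric dX) (HdY : is_metric dY).
Context {L : R} (HL : 1 <= L) {f : X -> Y} (HBLD : BLD dX dY f L).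
Context (HX : complete_length_space dX) (HY : complete_length_space dY).
Context {rho : R} (Hrho : 0 < rho) (Htb : forall x, totally_bounded dX (ball dX x rho)).

Lemma BLD_lipschitz x x' : dY (f x) (f x') <= L * dX x x'.
Proof.
  destruct HBLD as [_ [_ [_ Hlen]]]. apply Rnot_lt_le. intros Hlt.
  set (e := (dY (f x) (f x') - L * dX x x') / (2 * L)).
  assert (He : 0 < e) by (apply Rdiv_lt_0_compat; lra).
  destruct (proj2 HX x x' e He) as [b [Hb [<- [<- Hl]]]].
  apply (proj1 (Hlen b Hb)) in Hl.
  apply (length_le_endpoints HdY) with (t := 1) in Hl; [|lra].
  assert (L * e = (dY (f (b 0)) (f (b 1)) - L * dX (b 0) (b 1)) / 2) by (unfold e; field; lra).
  lra.
Qed.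

(* Lift an almost shortest path issued from [f u] in the direction of [z]. *)
Lemma BLD_descent K u z : L < K -> 0 < dY (f u) z ->
  exists v, v <> u /\ dX u v <= K * (dY (f u) z - dY (f v) z).
Proof.
  intros HK Hz. destruct HBLD as [Hc [Ho [Hdisc Hlen]]].
  destruct (local_path_lifting HdX HdY Hc u rho Ho Hdisc (proj1 HX) Hrho (Htb u))
    as [sigma [Hsigma Hlift]].
  set (delta := Rmin sigma (dY (f u) z) / 2).
  assert (Hdelta : 0 < delta) by (unfold delta; pose proof (Rmin_pos _ _ Hsigma Hz); lra).
  assert (Hdelta' : 2 * delta <= sigma /\ 2 * delta <= dY (f u) z).
  { unfold delta. pose proof (Rmin_l sigma (dY (f u) z)). pose proof (Rmin_r sigma (dY (f u) z)).
    lra. }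
  set (theta := (K - L) / (K + L)).
  assert (Htheta : 0 < theta) by (apply Rdiv_lt_0_compat; lra).
  assert (HKL : K * (1 - theta) = L * (1 + theta)) by (unfold theta; field; lra).
  assert (Htheta1 : theta < 1) by nra.
  assert (Htd : 0 < theta * delta) by nra.
  destruct (proj2 HY (f u) z (theta * delta) Htd) as [g [Hg [Hg0 [Hg1 Hgl]]]].
  destruct (path_dist_surj HdY g delta Hg) as [t [Ht Hgt]]; [rewrite Hg0, Hg1; lra|].
  pose proof (length_le_chain _ _ _ t 1 Hgl ltac:(lra) ltac:(lra)) as Hsplit.
  rewrite Hg1, Hgt in Hsplit. rewrite Hg0 in Hgt.
  destruct (proj2 HY (f u) (g t) (theta * delta) Htd) as [h [Hh [Hh0 [Hh1 Hhl]]]].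
  rewrite Hgt in Hhl.
  destruct (Hlift h Hh Hh0) as [b [Hb [Hb0 Hbh]]].
  { intros s Hs. pose proof (length_le_endpoints HdY h _ s Hhl Hs). rewrite Hh0 in *. nra. }
  apply (length_le_ext dY h (fun s => f (b s))) in Hhl.
  2:{ intros s Hs. symmetry. apply Hbh, Hs. }
  apply (proj2 (Hlen b Hb)) in Hhl.
  apply (length_le_endpoints HdX) with (t := 1) in Hhl; [|lra].
  pose proof (Hbh 1 ltac:(lra)) as Hb1. rewrite Hh1 in Hb1. rewrite Hb0 in Hhl.
  exists (b 1). split.
  - intros E. rewrite E in Hb1. rewrite <- Hb1, (dist_refl HdY) in Hgt. lra.
  - rewrite Hb1. eapply Rle_trans; [exact Hhl|].
    replace (L * (delta + theta * delta)) with (L * (1 + theta) * delta) by ring.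
    rewrite <- HKL. replace (K * (1 - theta) * delta) with (K * (delta - theta * delta)) by ring.
    apply Rmult_le_compat_l; lra.
Qed.

Lemma BLD_preimage K x z : L < K -> exists x', f x' = z /\ dX x x' <= K * dY (f x) z.
Proof.
  intros HK. destruct (ekeland HdX (fun u => dY (f u) z) K x) as [u [Hu Hmin]].
  - apply HX.
  - lra.
  - intros u. apply (dist_ge0 HdY).
  - intros u eps He. destruct (proj1 HBLD u eps He) as [dl [Hdl H]].
    exists dl. split; [assumption|]. intros v Hv. specialize (H v Hv).
    pose proof (dist_tri HdY (f u) (f v) z). pose proof (dist_tri HdY (f v) (f u) z).
    rewrite (dist_sym HdY (f v) (f u)) in *. apply Rabs_def1; lra.
  - exists u. pose proof (dist_ge0 HdY (f u) z) as Hge.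
    assert (E : f u = z).
    { apply (dist_eq0 HdY). apply Rle_antisym; [|assumption]. apply Rnot_lt_le. intros Hlt.
      destruct (BLD_descent K u z HK Hlt) as [v [Hne Hv]]. apply Hne, Hmin, Hv. }
    split; [assumption|]. cbv beta in Hu. rewrite E, (dist_refl HdY) in Hu. lra.
Qed.

Theorem BLD_LQ : LQ dX dY f L.
Proof.
  intros x r Hr. split.
  - intros z Hz. unfold ball in *. pose proof (dist_ge0 HdY (f x) z) as Hge.
    assert (HLd : L * dY (f x) z < r).
    { apply (Rmult_lt_compat_l L) in Hz; [|lra].
      replace (L * (r / L)) with r in Hz by (field; lra). exact Hz. }
    set (e := (r - L * dY (f x) z) / (dY (f x) z + 1)).
    assert (He : 0 < e) by (apply Rdiv_lt_0_compat; lra).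
    assert (e * (dY (f x) z + 1) = r - L * dY (f x) z) by (unfold e; field; lra).
    destruct (BLD_preimage (L + e) x z ltac:(lra)) as [x' [E Hx']].
    exists x'. split; [|assumption]. lra.
  - intros x' Hx'. unfold ball in *. pose proof (BLD_lipschitz x x'). nra.
Qed.
End FromBLD.

Theorem theorem1p1 (n : nat) :
  (* BLD => discrete LQ *)
  (forall (X Y : Type) (dX : X -> X -> R) (dY : Y -> Y -> R) (CX RX CY RY L : R) (f : X -> Y),
     is_metric dX -> is_metric dY ->
     bounded_geometry n dX CX RX -> bounded_geometry n dY CY RY -> 1 <= L ->
     BLD dX dY f L -> discrete_map dX f /\ LQ dX dY f L) /\
  (* discrete LQ => BLD, with L' depending only on L and the bounded geometry constants *)
  (exists Phi : R -> R -> R -> R -> R -> R,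
     forall (X Y : Type) (dX : X -> X -> R) (dY : Y -> Y -> R) (CX RX CY RY L : R) (f : X -> Y),
     is_metric dX -> is_metric dY ->
     bounded_geometry n dX CX RX -> bounded_geometry n dY CY RY -> 1 <= L ->
     1 <= Phi L CX RX CY RY /\
     (discrete_map dX f -> LQ dX dY f L -> BLD dX dY f (Phi L CX RX CY RY))) /\
  (* both C-bounded geometry: L' = C^4 L *)
  (forall (X Y : Type) (dX : X -> X -> R) (dY : Y -> Y -> R) (C RX RY L : R) (f : X -> Y),
     is_metric dX -> is_metric dY ->
     bounded_geometry n dX C RX -> bounded_geometry n dY C RY -> 1 <= L ->
     discrete_map dX f -> LQ dX dY f L -> BLD dX dY f (C ^ 4 * L)) /\
  (* strongly bounded geometry: L' = L *)
  (forall (X Y : Type) (dX : X -> X -> R) (dY : Y -> Y -> R) (L : R) (f : X -> Y),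
     is_metric dX -> is_metric dY ->
     strongly_bounded_geometry n dX -> strongly_bounded_geometry n dY -> 1 <= L ->
     discrete_map dX f -> LQ dX dY f L -> BLD dX dY f L).
Proof.
  split; [|split; [|split]].
  - intros X Y dX dY CX RX CY RY L f HdX HdY [HX [HC [HR Hch]]] [HY _] HL HBLD.
    split; [apply HBLD|].
    apply (BLD_LQ HdX HdY HL HBLD HX HY HR).
    intros x. apply (chart_ball_totally_bounded n dX CX RX x HC Hch).
  - exists (fun L _ _ _ _ => L). intros X Y dX dY CX RX CY RY L f HdX HdY _ _ HL.
    split; [assumption|]. intros Hd HLQ. apply discrete_LQ_BLD; assumption.
  - intros X Y dX dY C RX RY L f HdX HdY [_ [HC _]] _ HL Hd HLQ.
    apply BLD_weaken with L; [|apply discrete_LQ_BLD; assumption].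
    pose proof (pow_R1_Rle C 4 HC). nra.
  - intros X Y dX dY L f HdX HdY _ _ HL Hd HLQ. apply discrete_LQ_BLD; assumption.
Qed.
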